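(* Let $G=(S,\mathcal{F})$ be a local forest greedoid with rank function $r$. Then $$P_{\text{shadow}}^{\uparrow}(G)=\left\{x\in\mathbb{R}^S : x(U)\ge r(S)-r(S-U)\ \text{ for all } U\subseteq S\right\}.$$
   Context: Notation: $X+x=X\cup\{x\}$, $X-x=X\setminus\{x\}$, $X-Y=X\setminus Y$; for a vector (function) $x\in\mathbb{R}^S$ and $U\subseteq S$, $x(U)=\sum_{s\in U}x(s)$. A greedoid $G=(S,\mathcal{F})$ consists of a finite ground set $S$ and a family $\mathcal{F}\subseteq 2^S$ (the feasible sets) such that $\emptyset\in\mathcal{F}$, and whenever $X,Y\in\mathcal{F}$ with $|X|<|Y|$ there is $y\in Y-X$ with $X+y\in\mathcal{F}$. The rank of $A\subseteq S$ is $r(A)=\max\{|X| : X\subseteq A, X\in\mathcal{F}\}$. A base of $G$ is a feasible set of maximum size. $\mathcal{F}^{\vee}$ denotes the family of subfeasible sets, i.e. subsets of feasible sets. $G$ is a local forest greedoid if all of the following hold: - Local Union Property: if $A,B\in\mathcal{F}$ and $A\cup B\in\mathcal{F}^{\vee}$ then $A\cup B\in\mathcal{F}$; - Local Intersection Property: if $A,B\in\mathcal{F}$ and $A\cup B\in\mathcal{F}^{\vee}$ then $A\cap B\in\mathcal{F}$; - Local Forest Property: if $A, A+x, A+y, A\cup\{x,y\}, A\cup\{x,y,z\}\in\mathcal{F}$ then $A\cup\{x,z\}\in\mathcal{F}$ or $A\cup\{y,z\}\in\mathcal{F}$. For $A\in\mathcal{F}$ and $x\in S$, the shadow of $x$ on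 $A$ is $sh_A(x)=|A|-r(A-x)$; the shadow vector of $A$ is $sh_A=(sh_A(x))_{x\in S}\in\mathbb{R}^S$. The shadow polytope $P_{\text{shadow}}(G)$ is the convex hull of the shadow vectors of all bases of $G$. The up-hull of a polyhedron $P\subseteq\mathbb{R}^S$ is $P^{\uparrow}=\{x\in\mathbb{R}^S : \exists z\in P,\ z\le x\}$ (componentwise inequality). *)

(* Defs.v *)
From HB Require Import structures.
From mathcomp Require Import all_boot all_order all_algebra.
From mathcomp Require Import boolp classical_sets reals.

Set Implicit Arguments.
Unset Strict Implicit.
Unset Printing Implicit Defensive.

Import Order.TTheory GRing.Theory Num.Theory.

Local Open Scope ring_scope.
Local Open Scope classical_set_scope.

Section Greedoid.
Variable S : finType.

Record greedoid := Greedoid {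
  feasible : {set {set S}};
  feasible0 : finset.set0 \in feasible;
  feasible_augment : forall X Y : {set S},
    X \in feasible -> Y \in feasible -> (#|X| < #|Y|)%N ->
    exists2 y, y \in Y :\: X & y |: X \in feasible }.

Variable G : greedoid.

Definition rank (A : {set S}) : nat :=
  (\max_(X in feasible G | X \subset A) #|X|)%N.

Definition is_base (B : {set S}) : Prop :=
  B \in feasible G /\ forall X, X \in feasible G -> (#|X| <= #|B|)%N.

Definition subfeasible (A : {set S}) : Prop :=
  exists2 X, X \in feasible G & A \subset X.

Definition local_union : Prop := forall A B : {set S},
  A \in feasible G -> B \in feasible G ->
  subfeasible (A :|: B) -> A :|: B \in feasible G.

Definition local_intersection : Prop := forall A B : {set S},
  A \in feasible G -> B \in feasible G ->
  subfeasible (A :|: B) -> A :&: B \in feasible G.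

(* x, y, z need not be distinct or outside A: in each degenerate case one of
   the two conclusions is already among the hypotheses. *)
Definition local_forest : Prop := forall (A : {set S}) (x y z : S),
  A \in feasible G -> x |: A \in feasible G -> y |: A \in feasible G ->
  A :|: [set x; y]%SET \in feasible G ->
  A :|: [set x; y; z]%SET \in feasible G ->
  A :|: [set x; z]%SET \in feasible G \/ A :|: [set y; z]%SET \in feasible G.

Definition local_forest_greedoid : Prop :=
  [/\ local_union, local_intersection & local_forest].

End Greedoid.

Section Polytope.
Variables (R : realType) (S : finType).

Definition convex_hull (A : set {ffun S -> R}) : set {ffun S -> R} :=
  [set x | exists (n : nat) (p : 'I_n -> {ffun S -> R}) (c : 'I_n -> R),
     [/\ forall i, A (p i), forall i, 0 <= c i,
         \sum_i c i = 1 & forall s, x s = \sum_i c i * p i s]].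

Definition up_hull (P : set {ffun S -> R}) : set {ffun S -> R} :=
  [set x | exists2 z, P z & forall s, z s <= x s].

Variable G : greedoid S.

Definition shadow_vector (A : {set S}) : {ffun S -> R} :=
  [ffun x => #|A|%:R - (rank G (A :\ x)%SET)%:R].

Definition shadow_polytope : set {ffun S -> R} :=
  convex_hull [set v | exists2 B, is_base G B & v = shadow_vector B].

End Polytope.

Arguments shadow_vector R {S} G A.
Arguments shadow_polytope R {S} G.

(* Main.v *)
(* Below a base the feasible sets form a lattice, and intersecting the largest
   feasible sets avoiding the individual elements of [U] gives the inequality of
   [U] for shadow vectors.  Conversely, if [x] satisfies all these inequalities
   but lies outside the up-hull, then a theorem of the alternative yields
   weights [w > 0] with [w.x < w.sh_B] for every base [B].  This is refuted by
   Dijkstra's algorithm: [w.sh_B] is the sum of the [w]-lengths of the paths in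
   [B], so let a feasible set [A] grow by the continuation closest to the root.
   The complement of the set of continuations of [A] has rank [#|A|], so the
   increments of the distance are dual variables on these sets; they
   load each [s] by at most [w s], and their total value is the sum of the
   distances. *)

Require Import Defs.
From HB Require Import structures.
From mathcomp Require Import all_boot all_order all_algebra.
From mathcomp Require Import zify ring lra.

Set Implicit Arguments.
Unset Strict Implicit.
Unset Printing Implicit Defensive.

Import Order.TTheory GRing.Theory Num.Theory.

Local Open Scope ring_scope.

(** * Theorems of the alternative over an ordered field *)

Section Gordan.
Variables (R : realFieldType) (S : finType).
Implicit Types (a v : {ffun S -> R}) (K : {ffun S -> R} -> Prop).

Lemma exists_above_below (l : R) (his : seq R) :
  {in his, forall h, l < h} -> exists2 t, l < t & {in his, forall h, t < h}.
Proof.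
elim: his => [|h his IH] lhis; first by exists (l + 1) => //; rewrite ltrDl.
have lh : l < h by apply: lhis; rewrite inE eqxx.
have [k khis|t lt thi] := IH; first by apply: lhis; rewrite inE khis orbT.
exists (Num.min t ((l + h) / 2)); first by rewrite lt_min lt /=; lra.
move=> k; rewrite inE gt_min => /orP[/eqP->|/thi -> //].
by apply/orP; right; lra.
Qed.

Lemma exists_between (los his : seq R) :
  {in los & his, forall l h, l < h} ->
  exists2 t, {in los, forall l, l < t} & {in his, forall h, t < h}.
Proof.
elim: los => [|l los IH] lohi.
  elim: his {lohi} => [|h his [t _ thi]]; first by exists 0.
  exists (Num.min t (h - 1)) => // k; rewrite inE gt_min.
  by move=> /orP[/eqP->|/thi -> //]; apply/orP; right; rewrite ltrBlDr ltrDl.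
have [k h klo hhi|t lot thi] := IH.
  by apply: lohi => //; rewrite inE klo orbT.
have [lt_lt|le_tl] := ltP l t.
  by exists t => // k; rewrite inE => /orP[/eqP->|/lot].
have [h hhi|t' lt' t'hi] := @exists_above_below l his.
  by apply: lohi => //; rewrite inE eqxx.
exists t' => // k; rewrite inE => /orP[/eqP-> //|/lot kt].
exact: lt_trans (lt_le_trans kt le_tl) lt'.
Qed.

(* Fourier-Motzkin elimination, one coordinate of [cs] at a time: the vectors
   vanishing at the eliminated coordinate form again a cone. *)
Lemma gordan_coordinates (cs : seq S) K (L : seq {ffun S -> R}) :
    (forall u v, K u -> K v -> K (u + v)) ->
    (forall (c : R) v, 0 < c -> K v -> K [ffun s => c * v s]) ->
    (forall a, a \in L -> K a) ->
  (exists2 v, K v & {in cs, forall c, v c = 0}) \/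
  (exists w : S -> R, forall a, a \in L -> 0 < \sum_s w s * a s).
Proof.
elim: cs K L => [|c cs IH] K L KD KZ KL.
  case: L KL => [|a L] KL; first by right; exists (fun=> 0).
  by left; exists a => //; apply: KL; rewrite inE eqxx.
(* For [p c > 0 > q c] both coefficients are positive, and coordinate [c] cancels. *)
pose comb (p q : {ffun S -> R}) : {ffun S -> R} :=
  [ffun s => p c * q s] + [ffun s => - q c * p s].
pose L0 := [seq a : {ffun S -> R} <- L | a c == 0].
pose Lp := [seq a : {ffun S -> R} <- L | 0 < a c].
pose Ln := [seq a : {ffun S -> R} <- L | a c < 0].
pose L' := L0 ++ [seq comb p q | p <- Lp, q <- Ln].
have [||a|[v [Kv vc0] vcs]|[w wL']] := IH (fun v => K v /\ v c = 0) L'.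
- by move=> u v [Ku uc] [Kv vc]; split; [exact: KD | rewrite ffunE uc vc addr0].
- by move=> k v k0 [Kv vc]; split; [exact: KZ | rewrite ffunE vc mulr0].
- rewrite mem_cat => /orP[|/allpairsP[[p q] /=]].
    by rewrite mem_filter => /andP[/eqP-> /KL].
  rewrite !mem_filter => -[/andP[p0 /KL Kp] /andP[q0 /KL Kq] ->]; split.
    by apply: KD; apply: KZ => //; rewrite oppr_gt0.
  by rewrite !ffunE; lra.
- by left; exists v => // k; rewrite inE => /orP[/eqP->|/vcs].
right; pose D a := \sum_s w s * a s.
(* Adding [t] to [w c] changes [D a] to [D a + t * a c]. Positivity on [Lp] bounds [t] from below,
   on [Ln] from above; positivity on [comb p q] makes these bounds compatible. *)
have [l h|t lot thi] := @exists_between [seq - D p / p c | p <- Lp]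
                                        [seq - D q / q c | q <- Ln].
  move=> /mapP[p pL ->] /mapP[q qL ->].
  have := wL' (comb p q).
  rewrite mem_cat allpairs_f // orbT => /(_ isT).
  have -> : \sum_s w s * comb p q s = p c * D q - q c * D p.
    rewrite /D !mulr_sumr -sumrB; apply: eq_bigr => s _.
    by rewrite !ffunE; ring.
  move: pL qL; rewrite !mem_filter => /andP[p0 _] /andP[q0 _] pos.
  by rewrite ltr_pdivrMr // mulrAC ltr_ndivlMr //; nra.
exists (fun s => w s + t * (s == c)%:R) => a aL.
have -> : \sum_s (w s + t * (s == c)%:R) * a s = D a + t * a c.
  under eq_bigr do rewrite mulrDl; rewrite big_split /=; congr (_ + _).
  rewrite (bigD1 c) //= eqxx mulr1 big1 ?addr0 // => s /negPf->.
  by rewrite mulr0 mul0r.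
have [ac|ac|ac] := ltgtP (a c) 0.
- have /thi : - D a / a c \in [seq - D q / q c | q <- Ln].
    by apply: map_f; rewrite mem_filter ac.
  by rewrite ltr_ndivlMr //; lra.
- have /lot : - D a / a c \in [seq - D p / p c | p <- Lp].
    by apply: map_f; rewrite mem_filter ac.
  by rewrite ltr_pdivrMr //; lra.
- by rewrite ac mulr0 addr0; apply: wL'; rewrite mem_cat mem_filter ac eqxx aL.
Qed.

(** [K] may be any convex cone containing [L], chosen so that [K 0] is informative. *)
Lemma gordan K (L : seq {ffun S -> R}) :
    (forall u v, K u -> K v -> K (u + v)) ->
    (forall (c : R) v, 0 < c -> K v -> K [ffun s => c * v s]) ->
    (forall a, a \in L -> K a) ->
  K 0 \/ (exists w : S -> R, forall a, a \in L -> 0 < \sum_s w s * a s).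
Proof.
move=> KD KZ KL.
have [[v Kv v0]|] := gordan_coordinates (enum S) KD KZ KL; last by right.
by left; congr K: Kv; apply/ffunP => s; rewrite ffunE v0 ?mem_enum.
Qed.

(** Gordan's alternative for the [a i] together with the unit vectors, which force [w] to be
    positive. *)
Lemma ville (I : finType) (a : I -> {ffun S -> R}) :
  (exists l : I -> R, [/\ forall i, 0 <= l i, \sum_i l i = 1 &
      forall s, \sum_i l i * a i s <= 0]) \/
  (exists2 w : S -> R, forall s, 0 < w s & forall i, 0 < \sum_s w s * a i s).
Proof.
(* The vectors above some nonnegative combination of the [a i]. At [v = 0] the disjunction leaves
   only [0 < \sum_i l i], so [l] can be normalised. *)
pose K (v : {ffun S -> R}) := exists l : I -> R, [/\ forall i, 0 <= l i,
  0 < \sum_i l i \/ 0 < \sum_s v s & forall s, \sum_i l i * a i s <= v s].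
pose e (t : S) : {ffun S -> R} := [ffun s => (s == t)%:R].
have [|||[l [l0 + lv]]|[w wL]] := @gordan K ([seq a i | i : I] ++ [seq e t | t : S]).
- move=> u v [k [k0 kpos ku]] [l [l0 lpos lv]].
  exists (fun i => k i + l i); split=> [i||s]; first exact: addr_ge0.
    have : 0 <= \sum_i k i by apply: sumr_ge0.
    have : 0 <= \sum_i l i by apply: sumr_ge0.
    rewrite big_split /=; under [X in _ \/ 0 < X]eq_bigr do rewrite ffunE.
    rewrite big_split /= => ls ks.
    case: kpos lpos => [kpos|upos] [lpos|vpos];
      by [left; lra | right; lra].
  rewrite ffunE; apply: le_trans (lerD (ku s) (lv s)).
  by rewrite -big_split /= ler_sum // => i _; rewrite mulrDl.
- move=> c v c0 [l [l0 lpos lv]].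
  exists (fun i => c * l i); split=> [i||s]; first by rewrite mulr_ge0 // ltW.
    under [X in _ \/ 0 < X]eq_bigr do rewrite ffunE.
    by rewrite -!mulr_sumr !pmulr_rgt0.
  rewrite ffunE; under eq_bigr do rewrite -mulrA.
  by rewrite -mulr_sumr ler_wpM2l // ltW.
- move=> v; rewrite mem_cat => /orP[] /imageP[t _ ->].
    exists (fun i => (i == t)%:R); split=> [i||s]; first exact: ler0n.
      by left; rewrite (bigD1 t) //= eqxx big1 ?addr0 ?ltr01 // => i /negPf->.
    rewrite (bigD1 t) //= eqxx mul1r big1 ?addr0 // => i /negPf->.
    by rewrite mul0r.
  exists (fun=> 0); split=> [//||s].
    right; rewrite (bigD1 t) //= ffunE eqxx big1 ?addr0 ?ltr01 // => s /negPf st.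
    by rewrite ffunE st.
  by rewrite big1 ?ffunE ?ler0n // => i _; rewrite mul0r.
- rewrite [X in _ \/ 0 < X]big1 ?ltxx => [[lpos|//]|s _]; last by rewrite ffunE.
  left; exists (fun i => (\sum_j l j)^-1 * l i); split=> [i||s].
  + by rewrite mulr_ge0 // invr_ge0 ltW.
  + by rewrite -mulr_sumr mulVf ?gt_eqF.
  + under eq_bigr do rewrite -mulrA; rewrite -mulr_sumr pmulr_rle0 ?invr_gt0 //.
    by have := lv s; rewrite ffunE.
right; exists w => [t|i].
  have := wL (e t); rewrite mem_cat [X in _ || X]map_f ?mem_enum // orbT => /(_ isT).
  rewrite (bigD1 t) //= ffunE eqxx mulr1 big1 ?addr0 // => s /negPf st.
  by rewrite ffunE st mulr0.
by apply: wL; rewrite mem_cat map_f ?mem_enum.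
Qed.

End Gordan.

(** * Rank, augmentation and removal in a greedoid *)

Section Greedoids.
Variables (S : finType) (G : greedoid S).
Implicit Types (A B C T X Y : {set S}) (s x y : S).
Local Notation F := (feasible G).

Lemma leq_card_rank A X : X \in F -> X \subset A -> (#|X| <= rank G A)%N.
Proof. by move=> XF XA; apply: (leq_bigmax_cond (F := fun X => #|X|)); rewrite XF. Qed.

Lemma rank_attained A :
  exists X, [/\ X \in F, X \subset A & rank G A = #|X|].
Proof.
have [|X] := @eq_bigmax_cond _ [pred X | X \in F & X \subset A] (fun X => #|X|).
  by apply/card_gt0P; exists set0; rewrite inE feasible0 sub0set.
by rewrite inE => /andP[XF XA] rX; exists X; split.
Qed.

Lemma rank_base B : is_base G B -> rank G [set: S] = #|B|.
Proof.
move=> [BF Bmax]; apply/eqP; rewrite eqn_leq leq_card_rank ?subsetT // andbT.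
by have [X [XF _ ->]] := rank_attained [set: S]; apply: Bmax.
Qed.

Lemma is_base_rank B : B \in F -> rank G [set: S] = #|B| -> is_base G B.
Proof. by move=> BF rB; split=> // X XF; rewrite -rB leq_card_rank ?subsetT. Qed.

Lemma rank_feasible B : B \in F -> rank G B = #|B|.
Proof.
move=> BF; apply/eqP; rewrite eqn_leq leq_card_rank // andbT.
by have [X [_ XB ->]] := rank_attained B; rewrite subset_leq_card.
Qed.

Lemma rank_le A B : A \subset B -> (rank G A <= rank G B)%N.
Proof.
move=> AB; have [X [XF XA ->]] := rank_attained A.
by rewrite leq_card_rank // (subset_trans XA).
Qed.

Definition continuations A : {set S} := [set s | (s \notin A) && (s |: A \in F)].

(** A feasible set larger than [A] would augment [A] by one of its own elements, which is then a
    continuation. *)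
Lemma rank_setD_continuations A :
  A \in F -> (rank G ([set: S] :\: continuations A) <= #|A|)%N.
Proof.
move=> AF; have [X [XF XU ->]] := rank_attained ([set: S] :\: continuations A).
rewrite leqNgt; apply/negP => /(feasible_augment AF XF)[y].
rewrite inE => /andP[yA yX] yAF; move: (subsetP XU y yX).
by rewrite !inE yA yAF.
Qed.

Lemma continuations_neq0 A :
  A \in F -> (#|A| < rank G [set: S])%N -> exists x, x \in continuations A.
Proof.
move=> AF; have [X [XF _ ->]] := rank_attained [set: S].
move=> /(feasible_augment AF XF)[y]; rewrite inE => /andP[yA _] yAF.
by exists y; rewrite inE yA.
Qed.

(** Augmenting a largest feasible [Z] with [X \subset Z \proper Y] from [Y] can only give [Y]
    itself. *)
Lemma feasible_remove X Y :
  X \in F -> Y \in F -> X \proper Y -> exists2 y, y \in Y :\: X & Y :\ y \in F.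
Proof.
move=> XF YF XY.
pose P Z := [&& Z \in F, X \subset Z & Z \proper Y].
have PX : P X by rewrite /P XF subxx.
case: (arg_maxnP (fun Z : {set S} => #|Z|) PX) => Z /and3P[ZF XZ ZY] Zmax.
have [y] := feasible_augment ZF YF (proper_card ZY).
rewrite inE => /andP[yZ yY] yZF.
have yX : y \notin X by apply: contra yZ; exact: (subsetP XZ).
exists y; first by rewrite inE yX.
have yZY : y |: Z \subset Y by rewrite subUset sub1set yY proper_sub.
have: ~~ (y |: Z \proper Y).
  apply/negP => yZpY; have := Zmax (y |: Z); rewrite /P yZF yZpY.
  rewrite (subset_trans XZ (subsetUr _ _)) => /(_ isT) /=.
  by rewrite cardsU1 yZ add1n /= ltnn.
rewrite properE yZY negbK => YyZ; rewrite (_ : Y = y |: Z) ?setU1K //.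
by apply/eqP; rewrite eqEsubset YyZ.
Qed.

(** * Paths in a local forest greedoid *)

Hypothesis hG : local_forest_greedoid G.

Lemma feasibleU A X Y :
  A \in F -> X \in F -> Y \in F -> X \subset A -> Y \subset A -> X :|: Y \in F.
Proof.
case: hG => hU _ _ AF XF YF XA YA; apply: hU => //; exists A => //.
by rewrite subUset XA.
Qed.

Lemma feasibleI A X Y :
  A \in F -> X \in F -> Y \in F -> X \subset A -> Y \subset A -> X :&: Y \in F.
Proof.
case: hG => _ hI _ AF XF YF XA YA; apply: hI => //; exists A => //.
by rewrite subUset XA.
Qed.

(** In a rooted forest this is the path from the root to [s]. For feasible [A] containing [s], local
    intersection makes the set of minimum size the least one under inclusion. *)
Definition path_to A s : {set S} :=
  [arg min_(X < A | [&& X \in F, X \subset A & s \in X]) #|X|].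

Lemma path_toP A s : A \in F -> s \in A ->
  [/\ path_to A s \in F, path_to A s \subset A, s \in path_to A s &
      forall X, X \in F -> X \subset A -> s \in X -> path_to A s \subset X].
Proof.
move=> AF sA; rewrite /path_to; case: arg_minnP => [|P /and3P[PF PA sP] Pmin].
  by rewrite AF subxx.
split=> // X XF XA sX; apply/setIidPl/eqP; rewrite eqEcard subsetIl Pmin //.
by rewrite (feasibleI AF) // inE sP sX (subset_trans (subsetIl _ _)).
Qed.

(** Paths already found survive when [A] grows: the path in [B] lies inside [A] by its
    minimality. *)
Lemma path_to_subset A B s : A \in F -> B \in F -> A \subset B -> s \in A ->
  path_to B s = path_to A s.
Proof.
move=> AF BF AB sA; have sB := subsetP AB s sA.
have [PF PA sP Pmin] := path_toP AF sA; have [QF QB sQ Qmin] := path_toP BF sB.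
have QA := Qmin A AF AB sA.
by apply/eqP; rewrite eqEsubset Pmin // Qmin // (subset_trans PA).
Qed.

Lemma path_to_set0 s : s |: set0 \in F -> path_to (s |: set0) s = [set s].
Proof.
rewrite setU0 => sF; have [_ Ps sP _] := path_toP sF (set11 s).
by apply/eqP; rewrite eqEsubset Ps sub1set.
Qed.

(** Local union applies to [X] and [A] inside the feasible set [s |: B], and [X :|: A] is
    [s |: A]. *)
Lemma continuations_convex A B X s : A \subset B -> A \in F -> s \in continuations B ->
  X \in F -> s \in X -> X \subset s |: A -> s \in continuations A.
Proof.
move=> AB AF; rewrite inE => /andP[sB sBF] XF sX XA.
rewrite inE (contra (subsetP AB s)) //=.
have -> : s |: A = X :|: A.
  apply/eqP; rewrite eqEsubset !subUset sub1set inE sX /= subsetUr XA !subsetUr //.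
apply: (feasibleU sBF) => //; first exact: subset_trans XA (setUS _ AB).
exact: subset_trans AB (subsetUr _ _).
Qed.

(* The local forest property says that a path has a single last-but-one
   element: if [x] and [y] could both be removed last before [s], one of them
   could be bypassed. *)
Lemma path_to_new A x s : A \in F -> x \in continuations A ->
    s \in continuations (x |: A) -> s \notin continuations A ->
  path_to (s |: (x |: A)) s = s |: path_to (x |: A) x.
Proof.
move=> AF xA sC nsA.
move: (sC) (xA); rewrite !inE negb_or -andbA => /and3P[sx sA DF] /andP[nxA CF].
set C := x |: A in CF sC DF *; set D := s |: C in DF *.
have CD : C \subset D by apply: subsetUr.
have AC : A \subset C by apply: subsetUr.
have xC : x \in C by apply: setU11.
have [PF PD sP Pmin] := path_toP DF (setU11 s C).
have [QF QC xQ Qmin] := path_toP CF xC.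
set P := path_to D s in PF PD sP Pmin *; set Q := path_to C x in QF QC xQ Qmin *.
(* A path avoiding [x] would lie in [s |: A] and make [s] a continuation of [A]. *)
have xP : x \in P.
  apply: contraNT nsA => xP; apply: (continuations_convex AC AF sC PF sP).
  apply/subsetP => u uP; have := subsetP PD u uP; rewrite !inE.
  case/or3P => [-> //|/eqP ux|->]; last by rewrite orbT.
  by case/negP: xP; rewrite -ux.
have P1E : P :\ s = P :&: C.
  apply/setP => u; rewrite !inE; have := subsetP PD u; rewrite !inE.
  case: (u =P s) => [->|_] /=; last by case: (u \in P) => //= ->.
  by rewrite (negPf sx) (negPf sA) andbF.
have P1F : P :\ s \in F by rewrite P1E (feasibleI DF).
have P1C : P :\ s \subset C by rewrite P1E subsetIr.
have xP1 : x \in P :\ s by rewrite !inE xP eq_sym sx.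
have QP1 : Q \subset P :\ s by apply: Qmin.
suff -> : Q = P :\ s by rewrite setD1K.
apply/eqP; rewrite eqEsubset QP1; apply: contraT => nPQ.
have [|y] := @feasible_remove Q _ QF P1F; first by rewrite properE QP1.
rewrite 3!inE => /and3P[yQ ys yP] P1yF.
have yx : y != x by apply: contraNneq yQ => ->.
(* Both [x] and [y] can be removed last from [P :\ s], so the local forest property applies to [A'],
   [x], [y], [s]. Either outcome is a feasible set containing [s] but missing [x] or [y], against
   the minimality of [P]. *)
pose A' := P :\ s :\ y :\ x.
have A'E : A' = (P :\ s :\ y) :&: A.
  apply/setP => u; rewrite !inE; have := subsetP P1C u; rewrite !inE.
  case: (u =P x) => [->|_] /=; first by rewrite (negPf nxA) andbF.
  by case: (u == y) => //=; case: (u == s) => //=; case: (u \in P) => //= ->.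
have A'F : A' \in F.
  by rewrite A'E (feasibleI CF) // (subset_trans (subsetDl _ _)).
have xA'F : x |: A' \in F by rewrite setD1K // !inE eq_sym yx eq_sym sx xP.
have P1xF : P :\ s :\ x \in F.
  suff -> : P :\ s :\ x = (P :\ s) :&: A by rewrite (feasibleI CF).
  apply/setP => u; rewrite !inE; have := subsetP P1C u; rewrite !inE.
  case: (u =P x) => [->|_] /=; first by rewrite (negPf nxA) andbF.
  by case: (u == s) => //=; case: (u \in P) => //= ->.
have yA'E : y |: A' = P :\ s :\ x.
  apply/setP => u; rewrite !inE; case: (u =P y) => [->|_] //=.
  by rewrite yx ys yP.
have xyA'E : A' :|: [set x; y] = P :\ s.
  apply/setP => u; rewrite !inE; have [->|_] := eqVneq u y.
    by rewrite ys yP !orbT.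
  by have [->|_] := eqVneq u x; rewrite ?orbT ?orbF //= [x == s]eq_sym sx xP.
have xysA'E : A' :|: [set x; y; s] = P.
  by rewrite setUA xyA'E setUC setD1K.
have sub T : T \subset P -> A' :|: T \subset D.
  move=> TP; apply: subset_trans PD; rewrite subUset TP andbT.
  by rewrite (subset_trans (subsetDl _ _)) // (subset_trans (subsetDl _ _)) // subsetDl.
case: hG => _ _ /(_ A' x y s A'F xA'F); rewrite yA'E xyA'E xysA'E => hF.
case: (hF P1xF P1F PF) => TF.
- have /subsetP/(_ y yP) : P \subset A' :|: [set x; s].
    by apply: Pmin; rewrite ?sub ?subUset ?sub1set ?xP // !inE eqxx !orbT.
  by rewrite !inE eqxx (negPf yx) (negPf ys) andbF.
- have /subsetP/(_ x xP) : P \subset A' :|: [set y; s].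
    by apply: Pmin; rewrite ?sub ?subUset ?sub1set ?yP // !inE eqxx !orbT.
  by rewrite !inE eqxx [x == y]eq_sym (negPf yx) [x == s]eq_sym (negPf sx).
Qed.

(* The union of the paths avoiding [x] is feasible and contains their ends. *)
Lemma card_path_avoid B x : B \in F ->
  (#|[set b in B | x \notin path_to B b]| <= rank G (B :\ x))%N.
Proof.
move=> BF; pose T := \bigcup_(b in B | x \notin path_to B b) path_to B b.
have [TF TB xT] : [/\ T \in F, T \subset B & x \notin T].
  rewrite /T; elim/big_ind: _ => [|X Y [XF XB xX] [YF YB xY]|b /andP[bB xb]].
  - by rewrite feasible0 sub0set inE.
  - by rewrite (feasibleU BF) // subUset XB YB inE negb_or xX.
  - by have [? ? _ _] := path_toP BF bB.
apply: leq_trans (leq_card_rank TF _); last by rewrite subsetD1 TB.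
apply/subset_leq_card/subsetP => b; rewrite inE => /andP[bB xb].
apply/bigcupP; exists b; first by rewrite bB.
by have [] := path_toP BF bB.
Qed.

(* Intersecting maximum feasible subsets of the sets [B :\ u]. *)
Lemma rank_setD_base B (U : {set S}) : B \in F ->
  (#|B| <= rank G (B :\: U) + \sum_(u in U) (#|B| - rank G (B :\ u)))%N.
Proof.
move=> BF.
suff [X [XF XB XU leX]] : exists X, [/\ X \in F, X \subset B, [disjoint X & U] &
    (#|B| <= #|X| + \sum_(u in U) (#|B| - rank G (B :\ u)))%N].
  by apply: leq_trans leX _; rewrite leq_add2r leq_card_rank // subsetD XB.
rewrite -big_enum /=; suff H (us : seq S) : exists X, [/\ X \in F, X \subset B,
    {in us, forall u, u \notin X} &
    (#|B| <= #|X| + \sum_(u <- us) (#|B| - rank G (B :\ u)))%N].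
  have [X [XF XB XU leX]] := H (enum U); exists X; split=> //.
  rewrite disjoint_sym disjoint_subset; apply/subsetP => u uU.
  by rewrite inE XU ?mem_enum.
elim: us => [|u us [X [XF XB Xus leX]]].
  by exists B; rewrite BF subxx big_nil addn0.
have [Y [YF]] := rank_attained (B :\ u); rewrite subsetD1 => /andP[YB uY] rY.
exists (X :&: Y); split.
- exact: feasibleI BF _ _ _ _.
- exact: subset_trans (subsetIl _ _) XB.
- move=> k; rewrite inE => /orP[/eqP->|/Xus kX]; rewrite inE ?(negPf uY) ?andbF //.
  by rewrite (negPf kX).
(* As [X :|: Y] stays inside [B], the intersection loses at most [#|B| - #|Y|] elements, the shadow
   of [u]. *)
rewrite big_cons rY; have := cardsUI X Y.
have : (#|X :|: Y| <= #|B|)%N by rewrite subset_leq_card // subUset XB.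
have : (#|Y| <= #|B|)%N by rewrite subset_leq_card.
lia.
Qed.

Lemma rank_drop_le_sum_shadow (R : realFieldType) B (U : {set S}) : is_base G B ->
  (rank G [set: S])%:R - (rank G ([set: S] :\: U))%:R
    <= \sum_(s in U) (#|B|%:R - (rank G (B :\ s))%:R) :> R.
Proof.
move=> Bb; have BF : B \in F by case: Bb.
rewrite (rank_base Bb) lerBlDl.
under eq_bigr => s _.
  rewrite -natrB; last by rewrite -(rank_feasible BF) rank_le ?subsetDl.
  over.
rewrite -natr_sum -natrD ler_nat (leq_trans (rank_setD_base U BF)) //.
by rewrite leq_add2r rank_le // setSD ?subsetT.
Qed.

(** * Dijkstra's algorithm with its dual solution *)

Section Dijkstra.
Variables (R : realFieldType) (w x : S -> R).
Hypothesis w_ge0 : forall s, 0 <= w s.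
Hypothesis cut_le : forall U : {set S},
  (rank G [set: S])%:R - (rank G ([set: S] :\: U))%:R <= \sum_(s in U) x s.

Definition dist A s : R := \sum_(u in path_to A s) w u.

(* [l s] is the total weight of the cuts [continuations A'], [A'] an earlier
   state, through [s]; only their sum matters, so the cuts are not recorded. *)
Definition dijkstra_state A (d : R) (l : S -> R) : Prop :=
  [/\ A \in F,
      forall s, l s <= w s,
      forall s, l s != 0 -> exists X, [/\ X \in F, s \in X & X \subset s |: A],
      forall s, s \in continuations A ->
        d <= dist (s |: A) s /\ l s + dist (s |: A) s <= w s + d &
      \sum_(b in A) dist A b + d * ((rank G [set: S])%:R - #|A|%:R)
        <= \sum_s l s * x s].

Lemma dijkstra_init : dijkstra_state set0 0 (fun=> 0).
Proof.
split=> [|//|s|s|]; first exact: feasible0.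
- by rewrite eqxx.
- rewrite inE => /andP[_ sF]; rewrite /dist path_to_set0 // big_set1.
  by rewrite add0r addr0.
- by rewrite big_set0 mul0r addr0 big1 // => s _; rewrite mul0r.
Qed.

Lemma dijkstra_step A d l :
    dijkstra_state A d l -> (#|A| < rank G [set: S])%N ->
  exists A' d' l', dijkstra_state A' d' l' /\ #|A'| = #|A|.+1.
Proof.
move=> [AF lw lX lA val] Ar; have [c0 c0A] := continuations_neq0 AF Ar.
pose U := continuations A.
have [c cA cmin] : exists2 c, c \in U &
    forall s, s \in U -> dist (c |: A) c <= dist (s |: A) s.
  case: (Order.TotalTheory.arg_minP (fun s => dist (s |: A) s) c0A) => c cA cmin.
  by exists c.
set d' := dist (c |: A) c in cmin.
have dd' : d <= d' by have [] := lA c cA.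
(* The cut [U] receives the dual value [d' - d], the increase of the distance. *)
pose l' s := l s + (d' - d) * (s \in U)%:R.
move: (cA); rewrite inE => /andP[ncA cF].
have AcA : A \subset c |: A by apply: subsetUr.
have distA s : s \in continuations (c |: A) -> s \in U ->
    dist (s |: (c |: A)) s = dist (s |: A) s.
  rewrite !inE => /andP[_ sF] /andP[_ sAF].
  by rewrite /dist (path_to_subset sAF sF) ?setU11 // setUS.
have distU s : s \in continuations (c |: A) -> s \notin U ->
    dist (s |: (c |: A)) s = w s + d'.
  move=> sC nsU; rewrite /dist path_to_new // big_setU1 //=.
  move: sC; rewrite inE => /andP[sC _]; apply: contra sC.
  by have [_ /subsetP + _ _] := path_toP cF (setU11 c A); apply.
exists (c |: A), d', l'; split; last by rewrite cardsU1 ncA.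
split=> // [s|s|s sC|].
- rewrite /l'; have [sU|_] := boolP (s \in U); last by rewrite mulr0 addr0.
  by rewrite mulr1; have := cmin s sU; have [_] := lA s sU; lra.
- rewrite /l'; have [sU _|_] := boolP (s \in U).
    move: sU; rewrite inE => /andP[_ sF].
    by exists (s |: A); split; rewrite ?setU11 ?setUS.
  rewrite mulr0 addr0 => /lX[X [XF sX XA]]; exists X; split=> //.
  by rewrite (subset_trans XA) ?setUS.
- have [sU|nsU] := boolP (s \in U).
    rewrite distA // /l' sU; split; first exact: cmin.
    by rewrite mulr1; have [_] := lA s sU; lra.
  rewrite distU // /l' (negPf nsU) mulr0 addr0.
  (* A new continuation carries no load yet: a set [X] from an earlier cut through [s] would make
     [s] a continuation of [A]. *)
  have [->|ls0] := eqVneq (l s) 0; first by have := w_ge0 s; lra.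
  have [X [XF sX XA]] := lX s ls0.
  by rewrite (continuations_convex AcA AF sC XF sX XA) in nsU.
have -> : \sum_s l' s * x s = \sum_s l s * x s + (d' - d) * \sum_(s in U) x s.
  under eq_bigr do rewrite mulrDl -mulrA mulr_natl mulrb.
  rewrite big_split /= -mulr_sumr; congr (_ + _ * _).
  by rewrite -big_mkcond.
have cut : (rank G [set: S])%:R - #|A|%:R <= \sum_(s in U) x s.
  apply: le_trans (cut_le U); rewrite lerD2l lerN2 ler_nat.
  exact: rank_setD_continuations.
rewrite big_setU1 //= cardsU1 ncA add1n -natr1 -/d'.
rewrite (eq_bigr (dist A)); last first.
  by move=> b bA; rewrite /dist (path_to_subset AF cF).
have : 0 <= (d' - d) * (\sum_(s in U) x s - ((rank G [set: S])%:R - #|A|%:R)).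
  by rewrite mulr_ge0 // subr_ge0.
by move: val; lra.
Qed.

(** After exchanging the sums, [w s] counts once per path through [s]; by [card_path_avoid] there
    are at least [#|B| - rank G (B :\ s)] of these. *)
Lemma sum_shadow_le_dist B : B \in F ->
  \sum_s w s * (#|B|%:R - (rank G (B :\ s))%:R) <= \sum_(b in B) dist B b.
Proof.
move=> BF; under [leRHS]eq_bigr do rewrite /dist big_mkcond.
rewrite exchange_big /=; apply: ler_sum => s _.
apply: (@le_trans _ _ (w s * #|[set b in B | s \in path_to B b]|%:R)).
  rewrite ler_wpM2l // lerBlDr -natrD ler_nat.
  rewrite -(cardsID [set b | s \in path_to B b] B) setIdE leq_add2l.
  apply: leq_trans (card_path_avoid s BF); rewrite subset_leq_card //.
  by apply/subsetP => b; rewrite !inE andbC.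
rewrite -sum1_card natr_sum mulr_sumr big_mkcond [leRHS]big_mkcond /=.
by apply: ler_sum => b _; rewrite inE mulr1; case: (b \in B).
Qed.

(** At full rank the term with [d] vanishes, and [l s <= w s] bounds the dual value because the
    singleton cuts give [x >= 0]. *)
Lemma exists_base_shadow_le : exists2 B, is_base G B &
  \sum_s w s * (#|B|%:R - (rank G (B :\ s))%:R) <= \sum_s w s * x s.
Proof.
have x_ge0 s : 0 <= x s.
  have := cut_le [set s]; rewrite big_set1; apply: le_trans.
  by rewrite subr_ge0 ler_nat rank_le ?subsetT.
have [B [d [l [[BF lw _ _ val] cB]]]] : exists A d l,
    dijkstra_state A d l /\ #|A| = rank G [set: S].
  suff H k : (k <= rank G [set: S])%N ->
    exists A d l, dijkstra_state A d l /\ #|A| = k by exact: H.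
  elim: k => [_|k IH kr].
    by exists set0, 0, (fun=> 0); rewrite cards0; split=> //; exact: dijkstra_init.
  have [A [d [l [Adl cA]]]] := IH (ltnW kr).
  by rewrite -cA in kr *; apply: dijkstra_step Adl kr.
exists B; first exact: is_base_rank.
apply: le_trans (sum_shadow_le_dist BF) _.
move: val; rewrite cB subrr mulr0 addr0 => /le_trans; apply.
by apply: ler_sum => s _; rewrite ler_wpM2r.
Qed.

End Dijkstra.

End Greedoids.

(* The two inclusions for the up-hull *)
From mathcomp Require Import boolp classical_sets reals.

Local Open Scope classical_set_scope.

Theorem theorem6 (R : realType) (S : finType) (G : greedoid S)
    (hG : local_forest_greedoid G) :
  up_hull (shadow_polytope R G) =
  [set x : {ffun S -> R} | forall U : {set S},
     (rank G [set: S]%SET)%:R - (rank G ([set: S]%SET :\: U))%:R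
       <= \sum_(s in U) x s].
Proof.
apply/seteqP; split=> x /= => [[z [n [p [c [pB c0 c1 zE]]]] zx] U|xU].
  apply: le_trans (ler_sum _ (fun s _ => zx s)).
  under eq_bigr do rewrite zE.
  rewrite exchange_big /=; set d := leLHS.
  rewrite -[leLHS]mul1r -c1 mulr_suml ler_sum // => i _.
  rewrite -mulr_sumr ler_wpM2l //; have [B Bb ->] := pB i.
  under eq_bigr do rewrite ffunE.
  exact: rank_drop_le_sum_shadow.
pose bases : {set {set S}} :=
  [set B in feasible G | rank G [set: S]%SET == #|B|]%SET.
pose p (i : 'I_#|bases|) := shadow_vector R G (enum_val i).
(* Either some convex combination of the [p i] lies below [x], or some [w > 0] gives every [p i] a
   larger weight than [x]. *)
have [[c [c0 c1 cp]]|[w w0 wp]] := ville (fun i => p i - x).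
  exists [ffun s => \sum_i c i * p i s] => [|s].
    exists #|bases|, p, c; split=> // [i|s]; last by rewrite ffunE.
    exists (enum_val i) => //; have := enum_valP i; rewrite inE => /andP[BF /eqP].
    exact: is_base_rank.
  rewrite ffunE -subr_le0 -[x s]mul1r -c1 mulr_suml -sumrB.
  apply: le_trans (cp s); rewrite ler_sum // => i _.
  by rewrite [(p i - x) s]ffunE [(- x) s]ffunE mulrBr.
have [B Bb wB] := exists_base_shadow_le hG (fun s => ltW (w0 s)) xU.
have Bbases : B \in bases by rewrite inE (rank_base Bb) eqxx andbT; case: Bb.
have := wp (enum_rank_in Bbases B).
under eq_bigr do rewrite !ffunE enum_rankK_in // mulrBr.
by rewrite sumrB subr_gt0 ltNge wB.
Qed.
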